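(* Fix $N\ge 1$, $\alpha>0$, $\beta>0$, $\gamma\in\mathbb{R}$, $c\ge 0$, service rates $\mu_1,\dots,\mu_N>0$, and $\lambda>0$ with $\lambda<\Lambda:=\sum_{i=1}^N\mu_i$. Let $$V(Q):=\frac12\sum_{i=1}^N\frac{Q_i^2}{\mu_i^\beta},\qquad Q\in\mathbb{Z}_+^N.$$ Then there exist $\varepsilon>0$ and $R<\infty$ such that the generator $\mathcal{L}$ of the Reflected UAS queue-length continuous-time Markov chain satisfies the Foster–Lyapunov drift inequality $$(\mathcal{L}V)(Q)\le-\varepsilon|Q|_1+R\qquad\text{for all }Q\in\mathbb{Z}_+^N.$$
   Context: Here $\mathbb{Z}_+=\{0,1,2,\dots\}$ and $|Q|_1=\sum_{i=1}^NQ_i$; $e_i$ is the $i$-th standard basis vector. The Reflected UAS routing probabilities are $p_i(Q)=w_i(Q)/\sum_{j=1}^Nw_j(Q)$ with $w_i(Q)=\mu_i^\gamma\exp(-\alpha(Q_i+c)/\mu_i^\beta)$. The queue-length CTMC on $\mathbb{Z}_+^N$ has arrivals at rate $\lambda$, each joining queue $i$ with probability $p_i(Q)$, and service at rate $\mu_i$ at each nonempty queue $i$; its generator acts on functions $f:\mathbb{Z}_+^N\to\mathbb{R}$ by $$(\mathcal{L}f)(Q)=\lambda\sum_{i=1}^Np_i(Q)\bigl[f(Q+e_i)-f(Q)\bigr]+\sum_{i=1}^N\mu_i\mathbf{1}_{\{Q_i>0\}}\bigl[f(Q-e_i)-f(Q)\bigr],$$ where the $i$-th service term is $0$ when $Q_i=0$.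 *)

(* Defs.v *)
From mathcomp Require Import all_boot all_order all_algebra.
From mathcomp Require Import all_classical all_reals all_analysis.

Set Implicit Arguments.
Unset Strict Implicit.
Unset Printing Implicit Defensive.

Import Order.TTheory GRing.Theory Num.Theory.
Local Open Scope ring_scope.

Definition queue_state (N : nat) := {ffun 'I_N -> nat}.

Definition norm1 (N : nat) (Q : queue_state N) : nat := (\sum_(i < N) Q i)%N.

Definition arrive (N : nat) (Q : queue_state N) (i : 'I_N) : queue_state N :=
  [ffun j => (Q j + (j == i))%N].

(* [Q - e_i]; the subtraction is truncated, so this equals [Q] when [Q i = 0].
   It is only used under the indicator of [0 < Q i]. *)
Definition depart (N : nat) (Q : queue_state N) (i : 'I_N) : queue_state N :=
  [ffun j => (Q j - (j == i))%N].

Section ReflectedUAS.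
Context {R : realType} {N : nat}.
Variables (alpha beta gamma c lambda : R) (mu : 'I_N -> R).

Definition uas_weight (Q : queue_state N) (i : 'I_N) : R :=
  (mu i `^ gamma) * expR (- alpha * ((Q i)%:R + c) / (mu i `^ beta)).

Definition uas_prob (Q : queue_state N) (i : 'I_N) : R :=
  uas_weight Q i / \sum_(j < N) uas_weight Q j.

Definition uas_generator (f : queue_state N -> R) (Q : queue_state N) : R :=
  lambda * (\sum_(i < N) uas_prob Q i * (f (arrive Q i) - f Q))
  + \sum_(i < N) mu i * (0 < Q i)%N%:R * (f (depart Q i) - f Q).

Definition lyapunov (Q : queue_state N) : R :=
  2^-1 * \sum_(i < N) (Q i)%:R ^+ 2 / (mu i `^ beta).

End ReflectedUAS.

(* Main.v *)
Require Import Defs.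
From mathcomp Require Import all_boot all_order all_algebra.
From mathcomp Require Import ring.
From mathcomp Require Import all_classical all_reals all_analysis.

Set Implicit Arguments.
Unset Strict Implicit.
Unset Printing Implicit Defensive.

Import Order.TTheory GRing.Theory Num.Theory.
Local Open Scope ring_scope.

(* Write y_i = Q_i / mu_i^beta and M = sum_i mu_i.  Expanding the squares,
   LV(Q) <= lambda sum_i p_i y_i - sum_i mu_i y_i + const.  Since p is a softmax
   of -alpha y with bounded prior weights, and t exp(-alpha t) <= 1/alpha for
   every real t, the average sum_i p_i y_i exceeds each single y_j by at most a
   constant; averaging over j with weights mu_j / M gives
   sum_i p_i y_i <= (sum_j mu_j y_j) / M + const, so that
   LV(Q) <= - (1 - lambda / M) sum_i mu_i y_i + const. *)

Section ReflectedUASDrift.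
Context {R : realType} {N : nat}.
Variables (alpha beta gamma c lambda : R) (mu : 'I_N -> R).
Hypothesis (hmu : forall i, 0 < mu i).

Local Notation b i := (mu i `^ beta).
Local Notation V := (lyapunov beta mu).
Local Notation w := (uas_weight alpha beta gamma c mu).
Local Notation p := (uas_prob alpha beta gamma c mu).

Definition scaled_queue (Q : queue_state N) (i : 'I_N) : R := (Q i)%:R / b i.

(** These are the prior weights of the softmax: [gamma] and [c] enter only here, in a factor
    independent of [Q]. *)
Definition empty_weight : 'I_N -> R := w [ffun=> 0%N].

Local Notation y := scaled_queue.
Local Notation a := empty_weight.

Lemma scale_gt0 i : 0 < b i.
Proof. exact: powR_gt0. Qed.

Lemma uas_weight_gt0 Q i : 0 < w Q i.
Proof. by rewrite mulr_gt0 ?powR_gt0 ?expR_gt0. Qed.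

Lemma uas_weightE Q i : w Q i = a i * expR (- alpha * y Q i).
Proof.
rewrite /empty_weight /uas_weight ffunE -[RHS]mulrA -expRD /scaled_queue.
by congr (_ * expR _); ring.
Qed.

Lemma sum_uas_weight_gt0 Q (i : 'I_N) : 0 < \sum_j w Q j.
Proof.
rewrite (bigD1 i)//= ltr_pwDl ?uas_weight_gt0// sumr_ge0// => j _.
exact/ltW/uas_weight_gt0.
Qed.

Lemma uas_prob_ge0 Q i : 0 <= p Q i.
Proof. by rewrite divr_ge0 ?ltW ?uas_weight_gt0 ?(sum_uas_weight_gt0 Q i). Qed.

Lemma sum_uas_prob Q (i : 'I_N) : \sum_j p Q j = 1.
Proof. by rewrite -mulr_suml divff// gt_eqF// (sum_uas_weight_gt0 Q i). Qed.

Lemma uas_prob_le1 Q i : p Q i <= 1.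
Proof.
rewrite -(sum_uas_prob Q i) (bigD1 i)//= lerDl sumr_ge0// => j _.
exact: uas_prob_ge0.
Qed.

(** With t = y_i - y_j one has w_i = (a_i / a_j) exp(-alpha t) w_j. Bounding t exp(-alpha t) by 1 /
    alpha and w_j by the full normalizing sum gives a constant free of [Q]. *)
Lemma uas_prob_gap Q i j : 0 < alpha ->
  p Q i * (y Q i - y Q j) <= a i / (alpha * a j).
Proof.
move=> alpha0; have ai0 : 0 < a i := uas_weight_gt0 _ i.
have aj0 : 0 < a j := uas_weight_gt0 _ j.
have Z0 := sum_uas_weight_gt0 Q i.
(* Only positive denominators are cleared, so the sign of y_i - y_j never has to be examined. *)
rewrite /uas_prob mulrAC ler_pdivrMr// [leRHS]mulrAC (ler_pdivlMr _ _ (mulr_gt0 alpha0 aj0)).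
have wjZ : w Q j <= \sum_k w Q k.
  rewrite (bigD1 j)//= lerDl sumr_ge0// => k _.
  exact/ltW/uas_weight_gt0.
apply: le_trans (ler_wpM2l (ltW ai0) wjZ); rewrite !uas_weightE.
set t := y Q i - y Q j.
have -> : - alpha * y Q j = - alpha * y Q i + alpha * t by rewrite /t; ring.
rewrite expRD.
have te : alpha * t <= expR (alpha * t).
  by apply: le_trans (expR_ge1Dx _); rewrite lerDr.
have -> : a i * expR (- alpha * y Q i) * t * (alpha * a j) =
    a i * (a j * (expR (- alpha * y Q i) * (alpha * t))) by ring.
by rewrite !ler_wpM2l// ?expR_ge0// ltW.
Qed.

(** Since the probabilities sum to 1, y_j is its own average, and the pairwise gaps can be summed
    over i. *)
Lemma mean_scaled_queue_le Q j : 0 < alpha ->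
  \sum_i p Q i * y Q i <= y Q j + \sum_i a i / (alpha * a j).
Proof.
move=> alpha0; rewrite -lerBlDl -[y Q j]mul1r -(sum_uas_prob Q j).
rewrite mulr_suml -sumrB; apply: ler_sum => i _.
by rewrite -mulrBr uas_prob_gap.
Qed.

Lemma lyapunov_diff (Q Q' : queue_state N) i :
    (forall j, j != i -> Q' j = Q j) ->
  V Q' - V Q = 2^-1 * (((Q' i)%:R ^+ 2 - (Q i)%:R ^+ 2) / b i).
Proof.
move=> QQ'; rewrite /lyapunov -mulrBr -sumrB (bigD1 i)//= big1 ?addr0 => [|j ji].
  by rewrite mulrBl.
by rewrite QQ'// subrr.
Qed.

Lemma lyapunov_arrive Q i : V (arrive Q i) - V Q = y Q i + (2 * b i)^-1.
Proof.
have bi0 := lt0r_neq0 (scale_gt0 i).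
rewrite (@lyapunov_diff _ _ i) => [|j ji]; last by rewrite ffunE (negPf ji) addn0.
by rewrite ffunE eqxx natrD [true%:R]/= /scaled_queue; field.
Qed.

Lemma lyapunov_depart (Q : queue_state N) i : (0 < Q i)%N ->
  V (depart Q i) - V Q = - y Q i + (2 * b i)^-1.
Proof.
move=> Qi0; have bi0 := lt0r_neq0 (scale_gt0 i).
rewrite (@lyapunov_diff _ _ i) => [|j ji]; last by rewrite ffunE (negPf ji) subn0.
by rewrite ffunE eqxx natrB// [true%:R]/= /scaled_queue; field.
Qed.

Lemma uas_generator_lyapunov_le Q : 0 <= lambda ->
  uas_generator alpha beta gamma c lambda mu V Q <=
    lambda * (\sum_i p Q i * y Q i) - \sum_i mu i * y Q i
    + (lambda * (\sum_i (2 * b i)^-1) + \sum_i mu i * (2 * b i)^-1).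
Proof.
move=> lambda0; rewrite addrACA -mulrDr -sumrN -!big_split/=.
have b2 i : 0 <= (2 * b i)^-1 by rewrite invr_ge0 mulr_ge0// ltW// scale_gt0.
apply: lerD.
  apply: ler_wpM2l => //; apply: ler_sum => i _.
  (* The first-order terms agree; in the second-order term p_i is replaced by 1. *)
  by rewrite lyapunov_arrive mulrDr lerD2l ler_piMl ?uas_prob_le1.
apply: ler_sum => i _; rewrite [leRHS]addrC -[leRHS]mulrBr -[leLHS]mulrA ler_pM2l//.
(* A nonempty queue gives equality. For an empty one the left side and y_i vanish, leaving a
   nonnegative constant on the right. *)
have [Qi0|] := ltnP 0 (Q i); first by rewrite mul1r lyapunov_depart// addrC.
by rewrite leqn0 mul0r /scaled_queue => /eqP ->; rewrite mul0r subr0.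
Qed.

(** This turns the drift in the weighted sum into one in |Q|_1: every term mu_i y_i is nonnegative,
    hence at most the whole sum. *)
Lemma norm1_le_scaled Q :
  (norm1 Q)%:R <= (\sum_i b i / mu i) * \sum_i mu i * y Q i.
Proof.
have term0 j : 0 <= mu j * y Q j.
  by rewrite mulr_ge0 ?divr_ge0 ?ler0n// ltW// scale_gt0.
rewrite /norm1 natr_sum mulr_suml; apply: ler_sum => i _.
have -> : (Q i)%:R = b i / mu i * (mu i * y Q i).
  have := lt0r_neq0 (scale_gt0 i); have := lt0r_neq0 (hmu i).
  by rewrite /scaled_queue => ? ?; field; apply/andP.
apply: ler_wpM2l; first by rewrite divr_ge0// ltW// scale_gt0.
by rewrite [leRHS](bigD1 i)//= lerDl sumr_ge0.
Qed.

End ReflectedUASDrift.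

Theorem proposition6p1 (R : realType) (N : nat)
    (alpha beta gamma c lambda : R) (mu : 'I_N -> R)
    (hN : (1 <= N)%N) (halpha : 0 < alpha) (hbeta : 0 < beta) (hc : 0 <= c)
    (hmu : forall i : 'I_N, 0 < mu i)
    (hlambda : 0 < lambda) (hload : lambda < \sum_(i < N) mu i) :
  exists eps C : R, 0 < eps /\
    forall Q : queue_state N,
      uas_generator alpha beta gamma c lambda mu (lyapunov beta mu) Q
        <= - eps * (norm1 Q)%:R + C.
Proof.
pose i0 := Ordinal hN.
pose b i := mu i `^ beta.
pose a := empty_weight alpha beta gamma c mu.
pose M := \sum_i mu i; pose B := \sum_i b i / mu i.
pose K := \sum_j mu j * \sum_i a i / (alpha * a j).
pose C0 := lambda * (\sum_i (2 * b i)^-1) + \sum_i mu i * (2 * b i)^-1.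
have M0 : 0 < M := lt_trans hlambda hload.
have B0 : 0 < B.
  have bmu0 i : 0 < b i / mu i by rewrite divr_gt0// scale_gt0.
  rewrite /B (bigD1 i0)//= ltr_pwDl// sumr_ge0// => j _; exact: ltW.
have gap0 : 0 < 1 - lambda / M by rewrite subr_gt0 ltr_pdivrMr// mul1r.
(* The drift is at most -(1 - lambda / M) S + (lambda / M) K + C0, where S = sum_i mu_i y_i is at
   least |Q|_1 / B. *)
exists ((1 - lambda / M) / B), (lambda / M * K + C0).
split=> [|Q]; first exact: divr_gt0.
set S := \sum_i mu i * scaled_queue beta mu Q i.
have Pbound : \sum_i uas_prob alpha beta gamma c mu Q i
    * scaled_queue beta mu Q i <= (S + K) / M.
  (* Multiplying by M = sum_j mu_j splits the claim into the bound against each y_j, weighted by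
     mu_j; [K] collects the errors. *)
  rewrite ler_pdivlMr// mulrC mulr_suml -big_split/=; apply: ler_sum => j _.
  by rewrite -mulrDr ler_pM2l//; apply: mean_scaled_queue_le.
have Qbound : (norm1 Q)%:R / B <= S.
  by rewrite ler_pdivrMr// mulrC; apply: norm1_le_scaled.
apply: le_trans (uas_generator_lyapunov_le _ _ _ _ hmu _ (ltW hlambda)) _.
rewrite -/S -/C0 [leRHS]addrA lerD2r.
apply: (@le_trans _ _ (lambda * ((S + K) / M) - S)).
  by rewrite lerB// ler_wpM2l// ltW.
have -> : lambda * ((S + K) / M) - S = - ((1 - lambda / M) * S) + lambda / M * K.
  by ring.
by rewrite lerD2r mulNr lerN2 -mulrA ler_pM2l// mulrC.
Qed.
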